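(* (Weak maximum principle) Let $H=(V,E)$ be a connected finite hypergraph with vertex measure $\mu$ and hyperedge weight $\omega$. Let $c:V\to\mathbb{R}$ satisfy $c(v)>0$ for any $v\in V$. If a function $\phi:V\to\mathbb{R}$ satisfies $-\Delta\phi(v)+c(v)\phi(v)\ge0$ for all $v\in V$, then $\phi\ge0$ on $V$.
   Context: A (finite, undirected) hypergraph $H=(V,E)$ consists of a finite vertex set $V$ and a set $E$ of hyperedges, each hyperedge $e\in E$ being a subset of $V$ with cardinality $\delta_e:=|e|$ satisfying $2\le\delta_e\le|V|$. $H$ is connected if for any two different vertices $v,v'$ there is a sequence of hyperedges $e_1,\dots,e_l\in E$ with $v\in e_1$, $v'\in e_l$ and $e_n\cap e_{n+1}\ne\emptyset$ for $1\le n\le l-1$. The measure is a function $\mu:V\to(0,\infty)$ and the weight is a function $\omega:E\to(0,\infty)$, written $\omega_e=\omega(e)$. The Laplace operator (divergence of the hypergraph gradient) of $\phi:V\to\mathbb{R}$ is given explicitly by $$\Delta\phi(v)=\frac{1}{\mu(v)}\sum_{e\in E:\,v\in e}\frac{\omega_e}{\delta_e-1}\sum_{u\in e:\,u\ne v}(\phi(u)-\phi(v)),\quad v\in V.$$ *)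

(* Defs.v *)
From mathcomp Require Import all_boot all_order all_algebra.
From mathcomp Require Import reals.

Set Implicit Arguments.
Unset Strict Implicit.
Unset Printing Implicit Defensive.

Import GRing.Theory Num.Theory.

Local Open Scope ring_scope.

Record hypergraph (V : finType) := Hypergraph {
  hedges : {set {set V}};
  card_hedge : forall e : {set V}, e \in hedges -> (2 <= #|e| <= #|V|)%N
}.

(* The sequence e_1, ..., e_l (with l >= 1) is e :: s. *)
Definition hconnected (V : finType) (H : hypergraph V) : Prop :=
  forall v v' : V, v != v' ->
    exists (e : {set V}) (s : seq {set V}),
      [/\ {in e :: s, forall f, f \in hedges H},
          v \in e,
          v' \in last e s
        & path (fun f g : {set V} => f :&: g != set0) e s].

(* The weight w is a function on all subsets of V, but only its values on the
   hyperedges are used. *)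
Definition laplace (R : realType) (V : finType) (H : hypergraph V)
    (mu : V -> R) (w : {set V} -> R) (phi : V -> R) (v : V) : R :=
  (mu v)^-1 *
  \sum_(e in hedges H | v \in e)
    w e / (#|e|%:R - 1) * \sum_(u in e | u != v) (phi u - phi v).

(* Main.v *)
Require Import Defs.
From mathcomp Require Import all_boot all_order all_algebra.
From mathcomp Require Import reals.

Import Order.TTheory GRing.Theory Num.Theory.

Local Open Scope ring_scope.

(** At a minimum point [v0] of [phi] every difference [phi u - phi v0] is
    nonnegative, hence so is the Laplacian there ([laplace_min_ge0]). The
    supersolution inequality at [v0] then gives
    [c v0 * phi v0 >= laplace phi v0 >= 0], and dividing by [c v0 > 0] shows that
    the minimum value of [phi] is nonnegative. *)

Lemma laplace_min_ge0 (R : realType) (V : finType) (H : hypergraph V)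
    (mu : V -> R) (w : {set V} -> R) (phi : V -> R) (v0 : V) :
  (forall v, 0 <= mu v) -> (forall e, e \in hedges H -> 0 <= w e) ->
  (forall u, phi v0 <= phi u) ->
  0 <= laplace H mu w phi v0.
Proof.
move=> mu_ge0 w_ge0 phi_min.
apply: mulr_ge0; first by rewrite invr_ge0.
apply: sumr_ge0 => e /andP[eH _].
apply: mulr_ge0; last by apply: sumr_ge0 => u _; rewrite subr_ge0.
apply: divr_ge0; first exact: w_ge0.
(* The weight is divided by [#|e| - 1], positive because a hyperedge has at
   least two vertices. *)
have /andP[e_ge2 _] := card_hedge eH.
by rewrite subr_ge0 ler1n ltnW.
Qed.

Theorem lemma3p1 (R : realType) (V : finType) (H : hypergraph V)
    (mu : V -> R) (w : {set V} -> R) (c phi : V -> R)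
    (H_connected : hconnected H)
    (mu_gt0 : forall v : V, 0 < mu v)
    (w_gt0 : forall e : {set V}, e \in hedges H -> 0 < w e)
    (c_gt0 : forall v : V, 0 < c v)
    (phi_super : forall v : V, 0 <= - laplace H mu w phi v + c v * phi v) :
  forall v : V, 0 <= phi v.
Proof.
move=> v.
have [v0 _ phi_min] := @arg_minP _ R V v xpredT phi isT.
apply: le_trans (phi_min v isT).
rewrite -(pmulr_rge0 _ (c_gt0 v0)).
have := phi_super v0; rewrite addrC subr_ge0; apply: le_trans.
apply: laplace_min_ge0 => [u | e eH | u]; first exact: ltW.
- exact/ltW/w_gt0.
- exact: phi_min.
Qed.
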